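(* Let $G$ be an abelian group, $A$ a $G$-bigraded Hopf algebra over an algebraically closed field $F$, and $\sigma\colon G\times G\to F^*$ a skew bicharacter with a fixed bimultiplicative skew square root $\sigma^{1/2}$. Let $A\otimes F[G]$ carry the algebra structure $$(x\otimes e^{m})\cdot(y\otimes e^{k})=(x\cdot e^{k})(e^{m}\cdot y)\otimes e^{m+k},$$ where $e^m\cdot x=\sigma(m,g+h)^{1/2}x$ and $x\cdot e^m=\sigma(g+h,m)^{1/2}x$ for $x\in A_{g,h}$, and consider its subalgebra $$A'=\bigoplus_{g,h\in G}A_{g,h}\otimes e^{g-h}\subset A\otimes F[G].$$ Then the map $\varphi\colon A\to A'$ given by $\varphi(x)=x\otimes e^{g-h}$ for all $g,h\in G$, $x\in A_{g,h}$, defines an algebra isomorphism $\varphi\colon A_\sigma\to A'$.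
   Context: $G$ is written additively; $F[G]$ has basis $\{e^g\}_{g\in G}$ with $e^ge^h=e^{g+h}$. A Hopf algebra $A$ (coproduct $\Delta$, counit $\epsilon$, antipode $S$) is $G$-bigraded if it is $G\times G$-graded as an algebra, $A=\bigoplus_{\alpha,\beta\in G}A_{\alpha,\beta}$, and $\Delta(A_{\alpha,\beta})\subset\sum_{\gamma\in G}A_{\alpha,\gamma}\otimes A_{-\gamma,\beta}$, $\epsilon(A_{\alpha,\beta})=0$ if $\alpha+\beta\ne0$, and $S(A_{\alpha,\beta})\subset A_{\beta,\alpha}$. A skew bicharacter is a map $\sigma\colon G\times G\to F^*$ that is multiplicative in each argument with $\sigma(\alpha,\beta)=\sigma(\beta,\alpha)^{-1}$ and $\sigma(\alpha,\alpha)=1$. $A_\sigma$ is the vector space $A$ with the product $a\circ b=\sigma(\alpha,\alpha')\sigma(\beta,\beta')^{-1}ab$ for $a\in A_{\alpha,\beta}$, $b\in A_{\alpha',\beta'}$. The square root $\sigma^{1/2}\colon G\times G\to F^*$ is a skew bicharacter whose square is $\sigma$. *)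

(* Defs.v *)
From HB Require Import structures.
From mathcomp Require Import all_boot all_algebra.
From mathcomp Require Import finmap boolp.
From mathcomp Require Import monalg ring.

Set Implicit Arguments.
Unset Strict Implicit.
Unset Printing Implicit Defensive.

Import GRing.Theory.
Local Open Scope ring_scope.

Section LinearPredicate.
Variables (F : fieldType).

Lemma linear_eq_sum (U V : lmodType F) (f : U -> V) (I : Type) (s : seq I)
    (c : I -> F) (u : I -> U) :
  linear f -> f (\sum_(i <- s) c i *: u i) = \sum_(i <- s) c i *: f (u i).
Proof.
move=> lf.
have f0 : f 0 = 0 by have := lf (-1) 0 0; rewrite scaler0 addr0 scaleN1r addNr.
elim: s => [|i s IH]; first by rewrite !big_nil.
by rewrite !big_cons lf IH.
Qed.

Lemma linear_add (U V : lmodType F) (f : U -> V) : linear f ->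
  {morph f : x y / x + y}.
Proof. by move=> lf x y; have := lf 1 x y; rewrite !scale1r. Qed.

Lemma linear0_eq (U V : lmodType F) (f : U -> V) : linear f -> f 0 = 0.
Proof. by move=> lf; have := lf (-1) 0 0; rewrite scaler0 addr0 scaleN1r addNr. Qed.

Lemma linear_scale (U V : lmodType F) (f : U -> V) : linear f ->
  forall c, {morph f : x / c *: x}.
Proof.
by move=> lf c x; have := lf c x 0; rewrite !addr0 (linear0_eq lf) addr0.
Qed.

Lemma linear_comp (U V W : lmodType F) (f : V -> W) (g : U -> V) :
  linear f -> linear g -> linear (fun x => f (g x)).
Proof. by move=> lf lg c x y; rewrite lg lf. Qed.

Lemma linear_id (U : lmodType F) : linear (fun x : U => x).
Proof. by []. Qed.

Lemma linear_sumf (U V : lmodType F) (I : Type) (s : seq I) (f : I -> U -> V) :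
  (forall i, linear (f i)) -> linear (fun x => \sum_(i <- s) f i x).
Proof.
move=> lf c x y; rewrite scaler_sumr -big_split /=.
by apply: eq_bigr => i _; rewrite lf.
Qed.

Lemma linear_scalef (U V : lmodType F) (a : F) (f : U -> V) :
  linear f -> linear (fun x => a *: f x).
Proof. by move=> lf c x y; rewrite lf scalerDr !scalerA mulrC. Qed.

End LinearPredicate.

Section FreeModule.
Variables (F : fieldType) (K : choiceType).

(* The linear extension of f : K -> V to the free module on K. *)
Definition fext (V : lmodType F) (f : K -> V) (g : {malg F[K]}) : V :=
  \sum_(k <- msupp g) g@_k *: f k.

Lemma fextE (V : lmodType F) (f : K -> V) (g : {malg F[K]}) (d : {fset K}) :
  {subset msupp g <= d} -> fext f g = \sum_(k <- d) g@_k *: f k.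
Proof.
move=> sub; have le : fsubset (msupp g) d by apply/fsubsetP.
rewrite /fext (big_fset_incl _ le) // => k _ kN.
by rewrite mcoeff_outdom // scale0r.
Qed.

Lemma fext_linear (V : lmodType F) (f : K -> V) : linear (fext f).
Proof.
move=> c g h.
pose d := fsetU (msupp g) (fsetU (msupp h) (msupp (c *: g + h))).
have E x : {subset msupp x <= d} -> fext f x = \sum_(k <- d) x@_k *: f k.
  exact: fextE.
rewrite !E; try by move=> k kg; rewrite !in_fsetE kg ?orbT.
rewrite scaler_sumr -big_split /=; apply: eq_bigr => k _.
by rewrite mcoeffD mcoeffZ scalerDl scalerA.
Qed.

Lemma fextU (V : lmodType F) (f : K -> V) k : fext f << k >> = f k.
Proof.
rewrite (@fextE _ f _ (fset1 k)); last first.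
  by move=> x; apply/fsubsetP/msuppU_le.
by rewrite big_seq_fset1 mcoeffUU scale1r.
Qed.

Lemma monalg_linE (g : {malg F[K]}) : g = \sum_(k <- msupp g) g@_k *: << k >>.
Proof.
rewrite {1}[g]monalgE; apply: eq_bigr => k _; apply/malgP => x.
by rewrite mcoeffZ !mcoeffU mulrnAr mulr1.
Qed.

Lemma free_ext (V : lmodType F) (f1 f2 : {malg F[K]} -> V) :
  linear f1 -> linear f2 -> (forall k, f1 << k >> = f2 << k >>) -> f1 =1 f2.
Proof.
move=> l1 l2 e g; rewrite [g]monalg_linE !linear_eq_sum //.
by apply: eq_bigr => k _; rewrite e.
Qed.

Lemma fext_lin_param (U V : lmodType F) (f : K -> U -> V) g :
  (forall k, linear (f k)) -> linear (fun x => fext (fun k => f k x) g).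
Proof. by move=> lf; apply: linear_sumf => k; apply: linear_scalef. Qed.

End FreeModule.

Section Tensor.
Variables (F : fieldType) (U V : lmodType F).

(* The submodule generated by the bilinearity relations, as the intersection
   of all submodules containing them; U ⊗ V is the quotient by it. *)
Definition tensor_rel : {pred {malg F[(U * V)%type]}} := fun t =>
  `[< forall P : {pred {malg F[(U * V)%type]}}, submod_closed P ->
      (forall c u u' v,
        << (c *: u + u', v) >> - c *: << (u, v) >> - << (u', v) >> \in P) ->
      (forall c u v v',
        << (u, c *: v + v') >> - c *: << (u, v) >> - << (u, v') >> \in P) ->
      t \in P >].

Fact tensor_rel_submod : submod_closed tensor_rel.
Proof.
split=> [|c x y /asboolP hx /asboolP hy].
  by apply/asboolP => P [].
by apply/asboolP => P sP h1 h2; case: (sP) => _; apply; [apply: hx|apply: hy].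
Qed.

HB.instance Definition _ := GRing.isSubmodClosed.Build F _ tensor_rel
  (GRing.submod_closed_semi tensor_rel_submod).
HB.instance Definition _ := GRing.isZmodClosed.Build _ tensor_rel
  (GRing.submod_closedB tensor_rel_submod).

Definition tensor : Type :=
  Quotient.quot (tensor_rel : zmodClosed {malg F[(U * V)%type]}).

HB.instance Definition _ := GRing.Zmodule.on tensor.
HB.instance Definition _ := EqQuotient.on tensor.

Local Notation pi := (\pi_tensor%qT : {malg F[(U * V)%type]} -> tensor).

Lemma tensor_piE (x y : {malg F[(U * V)%type]}) :
  (pi x = pi y) <-> (x - y \in tensor_rel).
Proof.
rewrite (@Quotient.idealrBE _ (tensor_rel : zmodClosed _) x y).
by split=> [->|/eqP].
Qed.

Lemma pi_repr (t : tensor) : pi (repr t) = t.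
Proof. exact: reprK. Qed.

Lemma pi_sub x y : pi (x - y) = pi x - pi y.
Proof. exact: raddfB. Qed.

Lemma pi_add x y : pi (x + y) = pi x + pi y.
Proof. exact: raddfD. Qed.

Lemma repr_pi_rel x : repr (pi x) - x \in tensor_rel.
Proof. by apply/tensor_piE; rewrite pi_repr. Qed.

Definition tensor_scale (c : F) (t : tensor) : tensor := pi (c *: repr t).

Lemma pi_scale c x : pi (c *: x) = tensor_scale c (pi x).
Proof.
apply/tensor_piE; rewrite -scalerBr -opprB scalerN rpredN.
by apply: rpredZ; apply: repr_pi_rel.
Qed.

Fact tensor_scaleA c d t :
  tensor_scale c (tensor_scale d t) = tensor_scale (c * d) t.
Proof. by rewrite -[t]pi_repr -!pi_scale scalerA. Qed.

Fact tensor_scale1 : left_id 1 tensor_scale.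
Proof. by move=> t; rewrite -[t]pi_repr -!pi_scale scale1r. Qed.

Fact tensor_scaleDr : right_distributive tensor_scale +%R.
Proof.
move=> c t u; rewrite -[t]pi_repr -[u]pi_repr -pi_add -!pi_scale.
by rewrite scalerDr pi_add.
Qed.

Fact tensor_scaleDl t : {morph tensor_scale^~ t : c d / c + d}.
Proof.
by move=> c d; rewrite /= -[t]pi_repr -!pi_scale scalerDl pi_add.
Qed.

HB.instance Definition _ := GRing.Zmodule_isLmodule.Build F tensor
  tensor_scaleA tensor_scale1 tensor_scaleDr tensor_scaleDl.

End Tensor.

HB.lock Definition tpure (F : fieldType) (U V : lmodType F) (u : U) (v : V)
  : tensor U V := (\pi_(tensor U V) << (u, v) >>)%qT.

(* Only meaningful for bilinear b: see tlift_linear and tliftE. *)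
HB.lock Definition tlift (F : fieldType) (U V W : lmodType F) (b : U -> V -> W)
  (t : tensor U V) : W := fext (fun p => b p.1 p.2) (repr t).

Section TensorTheory.
Variables (F : fieldType) (U V : lmodType F).

Local Notation tensor := (tensor U V).
Local Notation tensor_rel := (@tensor_rel F U V).
Local Notation pi := (\pi_tensor%qT : {malg F[(U * V)%type]} -> tensor).
Local Notation tpure := (@tpure F U V).

Lemma pi_linear : linear pi.
Proof. by move=> c x y; rewrite pi_add pi_scale. Qed.

Lemma tpure_linearl v : linear (tpure^~ v).
Proof.
move=> c u u'; apply/eqP; rewrite -subr_eq0 opprD addrA; apply/eqP.
rewrite tpure.unlock -(linear_scale pi_linear) -!pi_sub.
rewrite -(linear0_eq pi_linear); apply/tensor_piE; rewrite subr0.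
by apply/asboolP => P _ h _; apply: h.
Qed.

Lemma tpure_linearr u : linear (tpure u).
Proof.
move=> c v v'; apply/eqP; rewrite -subr_eq0 opprD addrA; apply/eqP.
rewrite tpure.unlock -(linear_scale pi_linear) -!pi_sub.
rewrite -(linear0_eq pi_linear); apply/tensor_piE; rewrite subr0.
by apply/asboolP => P _ _ h; apply: h.
Qed.

Lemma tensor_ext (W : lmodType F) (f1 f2 : tensor -> W) :
  linear f1 -> linear f2 -> (forall u v, f1 (tpure u v) = f2 (tpure u v)) ->
  f1 =1 f2.
Proof.
rewrite tpure.unlock => l1 l2 e t; rewrite -[t]pi_repr.
apply: (free_ext (f1 := f1 \o pi) (f2 := f2 \o pi)) => [||[u v]].
- exact: linear_comp l1 pi_linear.
- exact: linear_comp l2 pi_linear.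
- exact: e.
Qed.

Section Lift.
Variables (W : lmodType F) (b : U -> V -> W).
Hypotheses (bl : forall v, linear (b^~ v)) (br : forall u, linear (b u)).

Let bb (p : U * V) := b p.1 p.2.

Lemma fext_rel x : x \in tensor_rel -> fext bb x = 0.
Proof.
have lb := fext_linear bb.
have lbN z : fext bb (- z) = - fext bb z.
  by rewrite -[- z]scaleN1r (linear_scale lb) scaleN1r.
move=> /asboolP/(_ [pred x | fext bb x == 0]) h; apply/eqP; apply: h.
- split=> [|c y z]; rewrite !inE ?(linear0_eq lb) //.
  by move=> /eqP y0 /eqP z0; rewrite lb y0 z0 scaler0 addr0.
- move=> c u u' v; rewrite inE !(linear_add lb) !lbN (linear_scale lb) !fextU.
  by rewrite /bb /= bl -addrA -opprD subrr.
- move=> c u v v'; rewrite inE !(linear_add lb) !lbN (linear_scale lb) !fextU.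
  by rewrite /bb /= br -addrA -opprD subrr.
Qed.

Lemma tlift_pi x : tlift b (pi x) = fext bb x.
Proof.
apply/eqP; rewrite -subr_eq0 -[- _]scaleN1r addrC tlift.unlock -fext_linear.
apply/eqP/fext_rel; rewrite scaleN1r addrC; exact: repr_pi_rel.
Qed.

Lemma tlift_linear : linear (tlift b).
Proof.
move=> c t u; rewrite -[t]pi_repr -[u]pi_repr -pi_linear !tlift_pi.
exact: fext_linear.
Qed.

Lemma tliftE u v : tlift b (tpure u v) = b u v.
Proof. by rewrite tpure.unlock tlift_pi fextU. Qed.

End Lift.

Lemma tlift_lin_param (X W : lmodType F) (b : X -> U -> V -> W) t :
  (forall u v, linear (fun x => b x u v)) -> linear (fun x => tlift (b x) t).
Proof.
move=> lb; rewrite tlift.unlock.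
exact: (fext_lin_param (f := fun p x => b x p.1 p.2)).
Qed.

End TensorTheory.

Notation "u *t v" := (tpure u v) (at level 40, format "u  *t  v") : ring_scope.
Notation "U ⊗ V" := (tensor U V) (at level 40) : type_scope.

Section BilinearMultiplication.
Variables (F : fieldType) (M : lmodType F) (S : M -> Prop).
Hypothesis ext : forall f1 f2 : M -> M, linear f1 -> linear f2 ->
  (forall x, S x -> f1 x = f2 x) -> f1 =1 f2.
Variable mul : M -> M -> M.
Hypotheses (ml : forall v, linear (mul^~ v)) (mr : forall u, linear (mul u)).

Lemma bilin_assoc :
  (forall x y z, S x -> S y -> S z -> mul x (mul y z) = mul (mul x y) z) ->
  associative mul.
Proof.
move=> h x y z.
apply: (ext (f1 := fun x => mul x (mul y z)) (f2 := fun x => mul (mul x y) z))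
  => [||{}x Sx]; [exact: ml|exact: linear_comp (ml z) (ml y)|].
apply: (ext (f1 := fun y => mul x (mul y z)) (f2 := fun y => mul (mul x y) z))
  => [||{}y Sy];
  [exact: linear_comp (mr x) (ml z)|exact: linear_comp (ml z) (mr x)|].
apply: (ext (f1 := fun z => mul x (mul y z)) (f2 := fun z => mul (mul x y) z))
  => [||{}z Sz]; [exact: linear_comp (mr x) (mr y)|exact: mr|exact: h].
Qed.

Lemma bilin_left_id e : (forall x, S x -> mul e x = x) -> left_id e mul.
Proof. by move=> h; apply: ext => //; exact: mr. Qed.

Lemma bilin_right_id e : (forall x, S x -> mul x e = x) -> right_id e mul.
Proof.
by move=> h; apply: (ext (f1 := mul^~ e) (f2 := id)) => //; exact: ml.
Qed.

Lemma bilin_Dl : left_distributive mul +%R.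
Proof. by move=> x y z; rewrite (linear_add (ml z)). Qed.

Lemma bilin_Dr : right_distributive mul +%R.
Proof. by move=> x y z; rewrite (linear_add (mr x)). Qed.

Lemma bilin_Al c x y : c *: mul x y = mul (c *: x) y.
Proof. by rewrite (linear_scale (ml y)). Qed.

Lemma bilin_Ar c x y : c *: mul x y = mul x (c *: y).
Proof. by rewrite (linear_scale (mr x)). Qed.

End BilinearMultiplication.

Section TensorLift2.
Variables (F : fieldType) (U V : lmodType F).
Variable q : U -> V -> U -> V -> U ⊗ V.
Hypothesis q1 : forall b a' b', linear (fun a => q a b a' b').
Hypothesis q2 : forall a a' b', linear (fun b => q a b a' b').
Hypothesis q3 : forall a b b', linear (fun a' => q a b a' b').
Hypothesis q4 : forall a b a', linear (fun b' => q a b a' b').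

Definition tlift2 (t u : U ⊗ V) : U ⊗ V :=
  tlift (fun a b => tlift (q a b) u) t.

Lemma tlift2_linearl u : linear (tlift2^~ u).
Proof.
apply: tlift_linear => [v|w]; first by apply: tlift_lin_param => a' b'; exact: q1.
by apply: tlift_lin_param => a' b'; exact: q2.
Qed.

Lemma tlift2_linearr t : linear (tlift2 t).
Proof.
apply: (tlift_lin_param (b := fun u a b => tlift (q a b) u)) => a b.
by apply: tlift_linear => [v|w]; [exact: q3|exact: q4].
Qed.

Lemma tlift2E a b a' b' : tlift2 (a *t b) (a' *t b') = q a b a' b'.
Proof.
rewrite /tlift2 tliftE; first by rewrite tliftE; [|exact: q3|exact: q4].
- by move=> v; apply: tlift_lin_param => *; exact: q1.
- by move=> v; apply: tlift_lin_param => *; exact: q2.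
Qed.

End TensorLift2.

Section TensorMaps.
Variable F : fieldType.

Definition tmap (U V U' V' : lmodType F) (f : U -> U') (g : V -> V')
  : U ⊗ V -> U' ⊗ V' := tlift (fun u v => f u *t g v).

Definition tassoc (U V W : lmodType F) : (U ⊗ V) ⊗ W -> U ⊗ (V ⊗ W) :=
  tlift (fun t w => tlift (fun u v => u *t (v *t w)) t).

End TensorMaps.

Section TensorAlgebra.
Variables (F : fieldType) (A B : algType F).

Definition tensor_mul : A ⊗ B -> A ⊗ B -> A ⊗ B :=
  tlift2 (fun a b a' b' => (a * a') *t (b * b')).

Fact mulr_linearl (C : algType F) (y : C) : linear ( *%R^~ y).
Proof. by move=> c x z; rewrite mulrDl -scalerAl. Qed.

Fact mulr_linearr (C : algType F) (x : C) : linear ( *%R x).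
Proof. by move=> c y z; rewrite mulrDr -scalerAr. Qed.

Fact tensor_mul_linearl u : linear (tensor_mul^~ u).
Proof.
apply: tlift2_linearl => [b a' b'|a a' b'].
- exact: linear_comp (tpure_linearl _) (mulr_linearl a').
- exact: linear_comp (tpure_linearr _) (mulr_linearl b').
Qed.

Fact tensor_mul_linearr u : linear (tensor_mul u).
Proof.
apply: tlift2_linearr => [a b b'|a b a'].
- exact: linear_comp (tpure_linearl _) (mulr_linearr a).
- exact: linear_comp (tpure_linearr _) (mulr_linearr b).
Qed.

Lemma tensor_mulE a b a' b' :
  tensor_mul (a *t b) (a' *t b') = (a * a') *t (b * b').
Proof.
rewrite /tensor_mul tlift2E // => *.
- exact: linear_comp (tpure_linearl _) (mulr_linearl _).
- exact: linear_comp (tpure_linearr _) (mulr_linearl _).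
- exact: linear_comp (tpure_linearl _) (mulr_linearr _).
- exact: linear_comp (tpure_linearr _) (mulr_linearr _).
Qed.

Let pure (t : A ⊗ B) := exists a b, t = a *t b.

Let pure_ext (f1 f2 : A ⊗ B -> A ⊗ B) : linear f1 -> linear f2 ->
  (forall x, pure x -> f1 x = f2 x) -> f1 =1 f2.
Proof.
by move=> l1 l2 h; apply: tensor_ext => // a b; apply: h; exists a, b.
Qed.

Fact tensor_mulA : associative tensor_mul.
Proof.
apply: (bilin_assoc pure_ext tensor_mul_linearl tensor_mul_linearr).
by move=> _ _ _ [a [b ->]] [a' [b' ->]] [c [d ->]]; rewrite !tensor_mulE !mulrA.
Qed.

Fact tensor_mul1l : left_id (1 *t 1) tensor_mul.
Proof.
apply: (bilin_left_id pure_ext tensor_mul_linearr).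
by move=> _ [a [b ->]]; rewrite tensor_mulE !mul1r.
Qed.

Fact tensor_mul1r : right_id (1 *t 1) tensor_mul.
Proof.
apply: (bilin_right_id pure_ext tensor_mul_linearl).
by move=> _ [a [b ->]]; rewrite tensor_mulE !mulr1.
Qed.

HB.instance Definition _ := GRing.Zmodule_isPzRing.Build (A ⊗ B)
  tensor_mulA tensor_mul1l tensor_mul1r
  (bilin_Dl tensor_mul_linearl) (bilin_Dr tensor_mul_linearr).

End TensorAlgebra.

Section GroupAlgebra.
Variables (F : fieldType) (G : zmodType).

(* The ring structure that monalg puts on {malg F[G]} requires G to be a monoid
   without nontrivial units, so the convolution product is redefined here. *)
Definition group_algebra : Type := {malg F[G]}.

HB.instance Definition _ := GRing.Lmodule.on group_algebra.

Definition gbasis (g : G) : group_algebra := << g >>.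

Definition group_algebra_mul (p q : group_algebra) : group_algebra :=
  fext (fun g => fext (fun h => gbasis (g + h)) q) p.

Fact gmul_linearl q : linear (group_algebra_mul^~ q).
Proof. exact: fext_linear. Qed.

Fact gmul_linearr p : linear (group_algebra_mul p).
Proof.
apply: (fext_lin_param (f := fun g q => fext (fun h => gbasis (g + h)) q)).
by move=> g; exact: fext_linear.
Qed.

Fact gmulE g h : group_algebra_mul (gbasis g) (gbasis h) = gbasis (g + h).
Proof. by rewrite /group_algebra_mul !fextU. Qed.

Let isbasis (p : group_algebra) := exists g, p = gbasis g.

Let basis_ext (f1 f2 : group_algebra -> group_algebra) :
  linear f1 -> linear f2 -> (forall x, isbasis x -> f1 x = f2 x) -> f1 =1 f2.
Proof.
by move=> l1 l2 h; apply: free_ext => // g; apply: h; exists g.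
Qed.

Fact gmulA : associative group_algebra_mul.
Proof.
apply: (bilin_assoc basis_ext gmul_linearl gmul_linearr).
by move=> _ _ _ [g ->] [h ->] [k ->]; rewrite !gmulE addrA.
Qed.

Fact gmul1l : left_id (gbasis 0) group_algebra_mul.
Proof.
apply: (bilin_left_id basis_ext gmul_linearr).
by move=> _ [g ->]; rewrite gmulE add0r.
Qed.

Fact gmul1r : right_id (gbasis 0) group_algebra_mul.
Proof.
apply: (bilin_right_id basis_ext gmul_linearl).
by move=> _ [g ->]; rewrite gmulE addr0.
Qed.

Fact gmul_nz : gbasis 0 != 0.
Proof.
apply/eqP => /(congr1 (fun x : {malg F[G]} => x@_0)).
by rewrite mcoeffUU mcoeff0 => /eqP; rewrite oner_eq0.
Qed.

HB.instance Definition _ := GRing.Zmodule_isNzRing.Build group_algebra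
  gmulA gmul1l gmul1r (bilin_Dl gmul_linearl) (bilin_Dr gmul_linearr) gmul_nz.
HB.instance Definition _ := GRing.Lmodule_isLalgebra.Build F group_algebra
  (bilin_Al gmul_linearl).
HB.instance Definition _ := GRing.Lalgebra_isAlgebra.Build F group_algebra
  (bilin_Ar gmul_linearr).

Lemma gbasisD g h : gbasis (g + h) = gbasis g * gbasis h.
Proof. by rewrite -gmulE. Qed.

End GroupAlgebra.

HB.mixin Record isHopf (F : fieldType) A of GRing.Algebra F A := {
  coprod : A -> A ⊗ A;
  counit : A -> F;
  antipode : A -> A;
  coprod_linear : linear coprod;
  coprod_multiplicative : monoid_morphism coprod;
  counit_linear : scalar counit;
  counit_multiplicative : monoid_morphism counit;
  antipode_linear : linear antipode;
  coprodA : forall a,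
    tassoc (tmap coprod idfun (coprod a)) = tmap idfun coprod (coprod a);
  counitl : forall a, tlift (fun x y => counit x *: y) (coprod a) = a;
  counitr : forall a, tlift (fun x y => counit y *: x) (coprod a) = a;
  antipodel : forall a, tlift *%R (tmap antipode idfun (coprod a)) = (counit a)%:A;
  antipoder : forall a, tlift *%R (tmap idfun antipode (coprod a)) = (counit a)%:A
}.

#[short(type="hopfType")]
HB.structure Definition Hopf (F : fieldType) :=
  {A of isHopf F A & GRing.Algebra F A}.

Section DirectSum.
Variables (F : fieldType) (I : choiceType) (V : lmodType F).
Variable W : I -> {pred V}.

Definition direct_sum : Prop :=
  (forall v, exists (s : seq I) (w : I -> V),
     [/\ uniq s, forall i, i \in s -> w i \in W i & v = \sum_(i <- s) w i]) /\
  (forall (s : seq I) (w : I -> V), uniq s ->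
     (forall i, i \in s -> w i \in W i) -> \sum_(i <- s) w i = 0 ->
     forall i, i \in s -> w i = 0).

Hypotheses (Wsub : forall i, submod_closed (W i)) (dir : direct_sum).

Definition is_decomp (v : V) (p : seq I * (I -> V)) :=
  [/\ uniq p.1, forall i, p.2 i \in W i, forall i, i \notin p.1 -> p.2 i = 0
    & v = \sum_(i <- p.1) p.2 i].

Lemma decomp_exists v : exists p, is_decomp v p.
Proof.
have [[span _] sub0] := (dir, fun i => (Wsub i).1).
have [s [w [us ws ->]]] := span v.
exists (s, fun i => if i \in s then w i else 0); split=> //=.
- by move=> i; case: ifP => // /ws.
- by move=> i /negPf ->.
- by rewrite big_seq [RHS]big_seq; apply: eq_bigr => i ->.
Qed.

Definition dsupp v : seq I := (sval (cid (decomp_exists v))).1.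
Definition dcomp v : I -> V := (sval (cid (decomp_exists v))).2.

Lemma dcompP v : is_decomp v (dsupp v, dcomp v).
Proof.
by rewrite /dsupp /dcomp; case: (cid (decomp_exists v)) => -[s w].
Qed.

Lemma sum_subset (M : lmodType F) (s u : seq I) (f : I -> M) : uniq s -> uniq u ->
  {subset s <= u} -> (forall i, i \notin s -> f i = 0) ->
  \sum_(i <- u) f i = \sum_(i <- s) f i.
Proof.
move=> us uu su f0; rewrite (bigID (mem s)) /= [X in _ + X]big1 => [|i /f0 //].
rewrite addr0 -big_filter; apply: perm_big; apply: uniq_perm => //.
  exact: filter_uniq.
by move=> i; rewrite mem_filter; apply/andP/idP => [[]//|is_]; split=> //; exact: su.
Qed.

Lemma dcomp_unique v s w : is_decomp v (s, w) -> dcomp v =1 w.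
Proof.
move=> [/= us ws w0 vs] i; have [/= ud wd d0 vd] := dcompP v.
pose u := undup (s ++ dsupp v).
have uu : uniq u by exact: undup_uniq.
have su : {subset s <= u} by move=> j js; rewrite mem_undup mem_cat js.
have du : {subset dsupp v <= u}.
  by move=> j js; rewrite mem_undup mem_cat js orbT.
have subP j x y : x \in W j -> y \in W j -> x - y \in W j.
  by move=> xW yW; rewrite addrC -scaleN1r; exact: (Wsub j).2.
have [iu|] := boolP (i \in u); last first.
  by rewrite mem_undup mem_cat negb_or => /andP[/w0 -> /d0 ->].
apply/eqP; rewrite -subr_eq0; apply/eqP.
apply: (dir.2 u (fun j => dcomp v j - w j)) => // [j _|]; first exact: subP.
by rewrite sumrB (sum_subset us uu su w0) (sum_subset ud uu du d0) -vs -vd subrr.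
Qed.

Lemma dcompE v u : uniq u -> {subset dsupp v <= u} -> v = \sum_(i <- u) dcomp v i.
Proof.
move=> uu du; have [/= ud wd d0 vd] := dcompP v.
by rewrite (sum_subset ud uu du d0).
Qed.

Lemma dcomp0 v i : i \notin dsupp v -> dcomp v i = 0.
Proof. by have [_ _ h _] := dcompP v => /h. Qed.

Lemma dcomp_in v i : dcomp v i \in W i.
Proof. by have [_ h _ _] := dcompP v; exact: h. Qed.

Lemma dcomp_linear i : linear (dcomp^~ i).
Proof.
move=> c x y; pose u := undup (dsupp x ++ dsupp y).
have uu : uniq u by exact: undup_uniq.
have xu : {subset dsupp x <= u} by move=> j js; rewrite mem_undup mem_cat js.
have yu : {subset dsupp y <= u}.
  by move=> j js; rewrite mem_undup mem_cat js orbT.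
apply: (dcomp_unique (s := u) (w := fun j => c *: dcomp x j + dcomp y j)).
split=> //= [j|j|].
- by apply: (Wsub j).2; exact: dcomp_in.
- rewrite mem_undup mem_cat negb_or => /andP[/dcomp0 -> /dcomp0 ->].
  by rewrite scaler0 addr0.
- by rewrite big_split -scaler_sumr /= -!dcompE.
Qed.

Lemma dcomp_homog v i : v \in W i -> dcomp v =1 fun j => if j == i then v else 0.
Proof.
move=> vW; apply: (dcomp_unique (s := [:: i])); split=> //= [j|j|].
- by case: eqP => [->|_] //; exact: (Wsub j).1.
- by rewrite inE => /negPf ->.
- by rewrite big_seq1 eqxx.
Qed.

(* The map v |-> \sum_i f i v_i, where v_i is the component of v in W i. *)
Definition dext (M : lmodType F) (f : I -> V -> M) (v : V) : M :=
  \sum_(i <- dsupp v) f i (dcomp v i).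

Lemma dextW (M : lmodType F) (f : I -> V -> M) v u : (forall i, linear (f i)) ->
  uniq u -> {subset dsupp v <= u} -> dext f v = \sum_(i <- u) f i (dcomp v i).
Proof.
move=> lf uu vu; have [/= ud _ _ _] := dcompP v.
rewrite (sum_subset ud uu vu) // => i /dcomp0 ->; exact: linear0_eq (lf i).
Qed.

Lemma dext_linear (M : lmodType F) (f : I -> V -> M) :
  (forall i, linear (f i)) -> linear (dext f).
Proof.
move=> lf c x y; pose u := undup (dsupp x ++ dsupp y ++ dsupp (c *: x + y)).
have uu : uniq u by exact: undup_uniq.
have E z : {subset dsupp z <= u} -> dext f z = \sum_(i <- u) f i (dcomp z i).
  exact: dextW.
rewrite !E; try by move=> k kg; rewrite mem_undup !mem_cat kg ?orbT.
rewrite scaler_sumr -big_split /=; apply: eq_bigr => i _.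
by rewrite dcomp_linear lf.
Qed.

Lemma dext_homog (M : lmodType F) (f : I -> V -> M) i v :
  (forall j, linear (f j)) -> v \in W i -> dext f v = f i v.
Proof.
move=> lf vW; rewrite (@dextW _ f v (undup (i :: dsupp v))) //; last 2 first.
- exact: undup_uniq.
- by move=> j js; rewrite mem_undup inE js orbT.
rewrite (eq_bigr (fun j => if j == i then f i v else 0)) => [|j _].
  rewrite -big_mkcond -big_filter (perm_big [:: i]) ?big_seq1 //.
  apply: uniq_perm => //; first by rewrite filter_uniq ?undup_uniq.
  by move=> j; rewrite mem_filter !mem_undup !inE /=; case: eqP.
rewrite (dcomp_homog vW); case: eqP => [->//|_]; exact: linear0_eq (lf j).
Qed.

Lemma dext_lin_param (X M : lmodType F) (f : X -> I -> V -> M) v :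
  (forall i x, linear (fun y => f y i x)) -> linear (fun y => dext (f y) v).
Proof. by move=> lf; apply: linear_sumf. Qed.

Lemma direct_ext (M : lmodType F) (f1 f2 : V -> M) : linear f1 -> linear f2 ->
  (forall v, (exists i, v \in W i) -> f1 v = f2 v) -> f1 =1 f2.
Proof.
move=> l1 l2 h v; have [/= ud vd _ vE] := dcompP v.
have E f : linear f -> f (\sum_(i <- dsupp v) dcomp v i) =
    \sum_(i <- dsupp v) f (dcomp v i) :> M.
  move=> lf; have := linear_eq_sum (dsupp v) (fun=> 1) (dcomp v) lf.
  rewrite (eq_bigr (dcomp v)) => [->|i _]; last by rewrite scale1r.
  by apply: eq_bigr => i _; rewrite scale1r.
transitivity (f1 (\sum_(i <- dsupp v) dcomp v i)); first by rewrite -vE.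
transitivity (f2 (\sum_(i <- dsupp v) dcomp v i)); last by rewrite -vE.
by rewrite !E //; apply: eq_bigr => i _; apply: h; exists i.
Qed.

End DirectSum.

Record skew_bicharacter (F : fieldType) (G : zmodType) := SkewBicharacter {
  skew_fun :> G -> G -> F;
  skew_neq0 : forall a b, skew_fun a b != 0;
  skewDl : forall a b c, skew_fun (a + b) c = skew_fun a c * skew_fun b c;
  skewDr : forall a b c, skew_fun a (b + c) = skew_fun a b * skew_fun a c;
  skewV : forall a b, skew_fun a b = (skew_fun b a)^-1;
  skew_diag : forall a, skew_fun a a = 1
}.

Record bigrading (F : fieldType) (G : zmodType) (A : hopfType F) := Bigrading {
  homog :> G -> G -> {pred A};
  homog_submod : forall g h, submod_closed (homog g h);
  homog_direct : direct_sum (fun i : G * G => homog i.1 i.2);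
  homog1 : 1 \in homog 0 0;
  homogM : forall g h g' h' a b, a \in homog g h -> b \in homog g' h' ->
    a * b \in homog (g + g') (h + h');
  (* the image lies in the sum over c of D g c ⊗ D (- c) h *)
  homog_coprod : forall g h a, a \in homog g h ->
    exists (n : nat) (c : 'I_n -> G) (x y : 'I_n -> A),
      (forall i, (x i \in homog g (c i)) /\ (y i \in homog (- c i) h)) /\
      coprod a = \sum_(i < n) x i *t y i;
  homog_counit : forall g h a, a \in homog g h -> g + h != 0 -> counit a = 0;
  homog_antipode : forall g h a, a \in homog g h -> antipode a \in homog h g
}.

(* A_s: the vector space A with the product twist_mul. *)
Definition twist (F : fieldType) (G : zmodType) (A : hopfType F)
  (D : bigrading G A) (s : skew_bicharacter F G) : Type := A.

Section Twists.
Variables (F : fieldType) (G : zmodType) (A : hopfType F) (D : bigrading G A).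

Let Dsub (i : G * G) : submod_closed (D i.1 i.2) := homog_submod D i.1 i.2.

Definition homog_ext (M : lmodType F) (f : G * G -> A -> M) : A -> M :=
  dext Dsub (homog_direct D) f.

Lemma homog_ext_linear (M : lmodType F) (f : G * G -> A -> M) :
  (forall i, linear (f i)) -> linear (homog_ext f).
Proof. exact: dext_linear. Qed.

Lemma homog_extE (M : lmodType F) (f : G * G -> A -> M) g h a :
  (forall i, linear (f i)) -> a \in D g h -> homog_ext f a = f (g, h) a.
Proof.
by move=> lf aD; apply: (dext_homog Dsub (homog_direct D) (i := (g, h)) lf).
Qed.

Lemma homog_ext_lin_param (X M : lmodType F) (f : X -> G * G -> A -> M) a :
  (forall i x, linear (fun y => f y i x)) -> linear (fun y => homog_ext (f y) a).
Proof. exact: dext_lin_param. Qed.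

Lemma homog_ind (M : lmodType F) (f1 f2 : A -> M) : linear f1 -> linear f2 ->
  (forall v, (exists g h, v \in D g h) -> f1 v = f2 v) -> f1 =1 f2.
Proof.
move=> l1 l2 h; apply: (direct_ext Dsub (homog_direct D)) => // v [[g k] vD].
by apply: h; exists g, k.
Qed.

Variable s : skew_bicharacter F G.

Lemma skew0l g : s 0 g = 1.
Proof.
apply: (mulfI (skew_neq0 s 0 g)); by rewrite -skewDl addr0 mulr1.
Qed.

Lemma skew0r g : s g 0 = 1.
Proof.
apply: (mulfI (skew_neq0 s g 0)); by rewrite -skewDr addr0 mulr1.
Qed.

(* The bilinear extension of the product a o b = s(g,g') s(h,h')^-1 ab for
   a in D g h and b in D g' h' (twist_mulE). *)
Definition twist_mul (a b : A) : A :=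
  homog_ext (fun i x => homog_ext (fun j y =>
    (s i.1 j.1 * (s i.2 j.2)^-1) *: (x * y)) b) a.

Let term_linl i j y : linear (fun x : A => (s i.1 j.1 * (s i.2 j.2)^-1) *: (x * y)).
Proof. by apply: linear_scalef; exact: mulr_linearl. Qed.

Let term_linr i j x : linear (fun y : A => (s i.1 j.1 * (s i.2 j.2)^-1) *: (x * y)).
Proof. by apply: linear_scalef; exact: mulr_linearr. Qed.

Let inner_linl b i : linear (fun x : A => homog_ext (fun j y =>
    (s i.1 j.1 * (s i.2 j.2)^-1) *: (x * y)) b).
Proof.
apply: (homog_ext_lin_param (f := fun x (j : G * G) y =>
  (s i.1 j.1 * (s i.2 j.2)^-1) *: (x * y))) => j x; exact: term_linl.
Qed.

Fact twist_mul_linearl b : linear (twist_mul^~ b).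
Proof. by apply: homog_ext_linear => i; exact: inner_linl. Qed.

Fact twist_mul_linearr a : linear (twist_mul a).
Proof.
apply: (homog_ext_lin_param (f := fun b (i : G * G) x => homog_ext (fun j y =>
    (s i.1 j.1 * (s i.2 j.2)^-1) *: (x * y)) b)) => i x.
by apply: homog_ext_linear => j; exact: term_linr.
Qed.

Lemma twist_mulE g h g' h' a b : a \in D g h -> b \in D g' h' ->
  twist_mul a b = (s g g' * (s h h')^-1) *: (a * b).
Proof.
move=> aD bD; rewrite /twist_mul (homog_extE _ aD) /=; last by move=> i; exact: inner_linl.
by rewrite (homog_extE _ bD) /= // => j; exact: (term_linr (g, h)).
Qed.

Let ishomog (a : A) := exists g h, a \in D g h.

Let homog_id_ext (f1 f2 : A -> A) : linear f1 -> linear f2 ->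
  (forall x, ishomog x -> f1 x = f2 x) -> f1 =1 f2.
Proof. exact: homog_ind. Qed.

Lemma homogZ g h c a : a \in D g h -> c *: a \in D g h.
Proof.
move=> aD; rewrite -[c *: a]addr0.
by apply: (homog_submod D g h).2 => //; exact: (homog_submod D g h).1.
Qed.

Fact twist_mulA : associative twist_mul.
Proof.
apply: (bilin_assoc homog_id_ext twist_mul_linearl twist_mul_linearr).
move=> x y z [g [h xD]] [g' [h' yD]] [k [l zD]].
rewrite (twist_mulE yD zD) (twist_mulE xD yD).
rewrite (linear_scale (twist_mul_linearr x)) (linear_scale (twist_mul_linearl z)).
rewrite (twist_mulE xD (homogM yD zD)) (twist_mulE (homogM xD yD) zD) !scalerA.
by rewrite mulrA; congr (_ *: _); rewrite !skewDl !skewDr !invfM; ring.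
Qed.

Fact twist_mul1l : left_id 1 twist_mul.
Proof.
apply: (bilin_left_id homog_id_ext twist_mul_linearr) => x [g [h xD]].
by rewrite (twist_mulE (homog1 D) xD) !skew0l invr1 !mul1r scale1r.
Qed.

Fact twist_mul1r : right_id 1 twist_mul.
Proof.
apply: (bilin_right_id homog_id_ext twist_mul_linearl) => x [g [h xD]].
by rewrite (twist_mulE xD (homog1 D)) !skew0r invr1 !mulr1 scale1r.
Qed.

HB.instance Definition _ := GRing.Lmodule.copy (twist D s) A.
HB.instance Definition _ := GRing.Zmodule_isNzRing.Build (twist D s)
  twist_mulA twist_mul1l twist_mul1r (bilin_Dl twist_mul_linearl)
  (bilin_Dr twist_mul_linearr) (oner_neq0 A).
HB.instance Definition _ := GRing.Lmodule_isLalgebra.Build F (twist D s)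
  (bilin_Al twist_mul_linearl).
HB.instance Definition _ := GRing.Lalgebra_isAlgebra.Build F (twist D s)
  (bilin_Ar twist_mul_linearr).

End Twists.

(* A ⊗ F[G] with the product crossed_mul, not the product of the tensor algebra. *)
Definition crossed (F : fieldType) (G : zmodType) (A : hopfType F)
  (D : bigrading G A) (r : skew_bicharacter F G) : Type := A ⊗ group_algebra F G.

Section CrossedTensor.
Variables (F : fieldType) (G : zmodType) (A : hopfType F) (D : bigrading G A).
Variable r : skew_bicharacter F G.

(* In this section r plays the role of the square root of the bicharacter:
   left_act m x is e^m . x and right_act x m is x . e^m. *)
Definition left_act (m : G) : A -> A :=
  homog_ext D (fun i x => r m (i.1 + i.2) *: x).

Definition right_act (x : A) (m : G) : A :=
  homog_ext D (fun i x => r (i.1 + i.2) m *: x) x.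

Lemma scale_linear (c : F) : linear (fun x : A => c *: x).
Proof. exact: linear_scalef. Qed.

Fact left_act_linear m : linear (left_act m).
Proof. by apply: homog_ext_linear => i; exact: scale_linear. Qed.

Fact right_act_linear m : linear (right_act^~ m).
Proof. by apply: homog_ext_linear => i; exact: scale_linear. Qed.

Lemma left_actE m g h x : x \in D g h -> left_act m x = r m (g + h) *: x.
Proof.
by move=> xD; rewrite /left_act (homog_extE (g := g) (h := h)) // => i;
   exact: scale_linear.
Qed.

Lemma right_actE m g h x : x \in D g h -> right_act x m = r (g + h) m *: x.
Proof.
by move=> xD; rewrite /right_act (homog_extE (g := g) (h := h)) // => i;
   exact: scale_linear.
Qed.

Let FG := group_algebra F G.

(* (x ⊗ e^m) (y ⊗ e^k) = (x . e^k) (e^m . y) ⊗ e^(m + k), extended bilinearly in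
   the elements p and q of F[G] and then to the tensor product (crossed_mulE). *)
Definition crossed_term (x : A) (p : FG) (y : A) (q : FG) : A ⊗ FG :=
  fext (fun m => fext (fun k =>
    (right_act x k * left_act m y) *t gbasis F (m + k)) q) p.

Definition crossed_mul (t u : A ⊗ FG) : A ⊗ FG := tlift2 crossed_term t u.

Fact crossed_term1 p y q : linear (fun x => crossed_term x p y q).
Proof.
apply: (fext_lin_param (f := fun m x => fext (fun k =>
  (right_act x k * left_act m y) *t gbasis F (m + k)) q)) => m.
apply: (fext_lin_param (f := fun k x =>
  (right_act x k * left_act m y) *t gbasis F (m + k))) => k.
apply: (linear_comp (tpure_linearl _)).
exact: linear_comp (mulr_linearl _) (right_act_linear k).
Qed.

Fact crossed_term2 x y q : linear (fun p => crossed_term x p y q).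
Proof. exact: fext_linear. Qed.

Fact crossed_term3 x p q : linear (fun y => crossed_term x p y q).
Proof.
apply: (fext_lin_param (f := fun m y => fext (fun k =>
  (right_act x k * left_act m y) *t gbasis F (m + k)) q)) => m.
apply: (fext_lin_param (f := fun k y =>
  (right_act x k * left_act m y) *t gbasis F (m + k))) => k.
apply: (linear_comp (tpure_linearl _)).
exact: linear_comp (mulr_linearr _) (left_act_linear m).
Qed.

Fact crossed_term4 x p y : linear (crossed_term x p y).
Proof.
apply: (fext_lin_param (f := fun m q => fext (fun k =>
  (right_act x k * left_act m y) *t gbasis F (m + k)) q)) => m.
exact: fext_linear.
Qed.

Fact crossed_mul_linearl u : linear (crossed_mul^~ u).
Proof.
by apply: tlift2_linearl => *; [exact: crossed_term1|exact: crossed_term2].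
Qed.

Fact crossed_mul_linearr t : linear (crossed_mul t).
Proof.
by apply: tlift2_linearr => *; [exact: crossed_term3|exact: crossed_term4].
Qed.

Lemma crossed_mulE x m y k : crossed_mul (x *t gbasis F m) (y *t gbasis F k) =
  (right_act x k * left_act m y) *t gbasis F (m + k).
Proof.
rewrite /crossed_mul tlift2E; first by rewrite /crossed_term !fextU.
- exact: crossed_term1.
- exact: crossed_term2.
- exact: crossed_term3.
- exact: crossed_term4.
Qed.

Lemma crossed_mul_homogE g h x m g' h' y k : x \in D g h -> y \in D g' h' ->
  crossed_mul (x *t gbasis F m) (y *t gbasis F k) =
  (r (g + h) k * r m (g' + h')) *: ((x * y) *t gbasis F (m + k)).
Proof.
move=> xD yD; rewrite crossed_mulE (right_actE _ xD) (left_actE _ yD).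
rewrite -scalerAl -scalerAr scalerA.
by rewrite (linear_scale (tpure_linearl (gbasis F (m + k)))).
Qed.

Let gen (t : A ⊗ FG) := exists g h x m, x \in D g h /\ t = x *t gbasis F m.

Fact crossed_ext (M : lmodType F) (f1 f2 : A ⊗ FG -> M) : linear f1 -> linear f2 ->
  (forall x, gen x -> f1 x = f2 x) -> f1 =1 f2.
Proof.
move=> l1 l2 h; apply: tensor_ext => // x p.
apply: (free_ext (f1 := fun p : {malg F[G]} => f1 (x *t (p : FG)))
                 (f2 := fun p : {malg F[G]} => f2 (x *t (p : FG)))).
- exact: linear_comp l1 (tpure_linearr x).
- exact: linear_comp l2 (tpure_linearr x).
move=> m.
apply: (homog_ind (D := D) (f1 := fun x => f1 (x *t gbasis F m))
                 (f2 := fun x => f2 (x *t gbasis F m))).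
- exact: linear_comp l1 (tpure_linearl _).
- exact: linear_comp l2 (tpure_linearl _).
by move=> v [g [k vD]]; apply: h; exists g, k, v, m.
Qed.

Fact crossed_mulA : associative crossed_mul.
Proof.
apply: (bilin_assoc (@crossed_ext _) crossed_mul_linearl crossed_mul_linearr).
move=> _ _ _ [g [h [x [m [xD ->]]]]] [g' [h' [y [k [yD ->]]]]]
  [a [b [z [l [zD ->]]]]].
rewrite (crossed_mul_homogE _ _ xD yD).
rewrite (crossed_mul_homogE _ _ yD zD).
rewrite (linear_scale (crossed_mul_linearr (x *t gbasis F m))).
rewrite (linear_scale (crossed_mul_linearl (z *t gbasis F l))).
rewrite (crossed_mul_homogE _ _ xD (homogM yD zD)).
rewrite (crossed_mul_homogE _ _ (homogM xD yD) zD).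
rewrite !scalerA [x * _]mulrA [m + (k + l)]addrA.
by congr (_ *: _); rewrite !skewDl !skewDr; ring.
Qed.

Fact crossed_mul1l : left_id (1 *t 1) crossed_mul.
Proof.
apply: (bilin_left_id (@crossed_ext _) crossed_mul_linearr).
move=> _ [g [h [x [m [xD ->]]]]].
rewrite (crossed_mul_homogE _ _ (homog1 D) xD).
by rewrite addr0 !skew0l !mul1r scale1r add0r.
Qed.

Fact crossed_mul1r : right_id (1 *t 1) crossed_mul.
Proof.
apply: (bilin_right_id (@crossed_ext _) crossed_mul_linearl).
move=> _ [g [h [x [m [xD ->]]]]].
rewrite (crossed_mul_homogE _ _ xD (homog1 D)).
by rewrite !addr0 !skew0r !mulr1 scale1r.
Qed.

(* id_A ⊗ (the augmentation of F[G]). *)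
Definition forget : A ⊗ FG -> A :=
  tlift (fun x (p : FG) => fext (fun=> x) p).

Lemma forget_linear : linear forget.
Proof.
apply: tlift_linear => [p|x]; last exact: fext_linear.
exact: (fext_lin_param (f := fun _ x => x)).
Qed.

Lemma forgetE x m : forget (x *t gbasis F m) = x.
Proof.
rewrite /forget tliftE ?fextU // => [p|{}x]; last exact: fext_linear.
exact: (fext_lin_param (f := fun _ x => x)).
Qed.

Fact crossed_one_nz : 1 *t 1 != 0 :> A ⊗ FG.
Proof.
apply/eqP => /(congr1 forget); rewrite forgetE (linear0_eq forget_linear).
by apply/eqP; exact: oner_neq0.
Qed.

Local Notation crossed := (crossed D r).

HB.instance Definition _ := GRing.Lmodule.copy crossed (A ⊗ FG).
HB.instance Definition _ := GRing.Zmodule_isNzRing.Build crossed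
  crossed_mulA crossed_mul1l crossed_mul1r (bilin_Dl crossed_mul_linearl)
  (bilin_Dr crossed_mul_linearr) crossed_one_nz.
HB.instance Definition _ := GRing.Lmodule_isLalgebra.Build F crossed
  (bilin_Al crossed_mul_linearl).
HB.instance Definition _ := GRing.Lalgebra_isAlgebra.Build F crossed
  (bilin_Ar crossed_mul_linearr).

Definition diag_tensor (g h : G) (x : A) : crossed := x *t gbasis F (g - h).

(* The sum of the subspaces D g h ⊗ e^(g - h); it is direct by diag_direct. *)
Definition diag_pred : {pred crossed} := fun t =>
  `[< exists (n : nat) (c : 'I_n -> G * G) (x : 'I_n -> A),
      (forall i, x i \in D (c i).1 (c i).2) /\
      t = \sum_(i < n) diag_tensor (c i).1 (c i).2 (x i) >].

Lemma diag_direct (s : seq (G * G)) (x : G * G -> A) : uniq s ->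
  (forall i, i \in s -> x i \in D i.1 i.2) ->
  \sum_(i <- s) diag_tensor i.1 i.2 (x i) = 0 -> forall i, i \in s -> x i = 0.
Proof.
move=> us xD /(congr1 forget).
under eq_bigr do rewrite -[diag_tensor _ _ _]scale1r.
rewrite (linear_eq_sum s (fun=> 1) _ forget_linear) (linear0_eq forget_linear).
under eq_bigr do rewrite scale1r forgetE.
exact: (homog_direct D).2.
Qed.

Lemma diag_gen g h x : x \in D g h -> diag_tensor g h x \in diag_pred.
Proof.
move=> xD; apply/asboolP; exists 1, (fun=> (g, h)), (fun=> x).
by rewrite big_ord1.
Qed.

Fact diag_subalg : subalg_closed diag_pred.
Proof.
have dlin g h : linear (diag_tensor g h) by exact: tpure_linearl.
have add t u : t \in diag_pred -> u \in diag_pred -> t + u \in diag_pred.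
  move=> /asboolP[n [c [x [xD ->]]]] /asboolP[n' [c' [x' [xD' ->]]]].
  apply/asboolP; exists (n + n')%N,
    (fun i => match split i with inl j => c j | inr j => c' j end),
    (fun i => match split i with inl j => x j | inr j => x' j end).
  split=> [i|]; first by case: (split i).
  rewrite big_split_ord /=; congr (_ + _); apply: eq_bigr => i _.
    by rewrite (unsplitK (inl i)).
  by rewrite (unsplitK (inr i)).
have scal a t : t \in diag_pred -> a *: t \in diag_pred.
  move=> /asboolP[n [c [x [xD ->]]]].
  apply/asboolP; exists n, c, (fun i => a *: x i); split=> [i|].
    exact: homogZ.
  rewrite scaler_sumr; apply: eq_bigr => i _.
  by rewrite (linear_scale (dlin _ _)).
have zero : 0 \in diag_pred.
  apply/asboolP; exists 0%N, (fun=> 0), (fun=> 0); split=> [[]//|].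
  by rewrite big_ord0.
have sumD n (f : 'I_n -> crossed) :
    (forall i, f i \in diag_pred) -> \sum_(i < n) f i \in diag_pred.
  by move=> fD; elim/big_ind: _ => // t u; exact: add.
split=> [|a t u td ud|t u].
- by rewrite -[1]/(1 *t gbasis F 0) -(subr0 0); exact: diag_gen (homog1 D).
- by apply: add => //; exact: scal.
move=> /asboolP[n [c [x [xD ->]]]] /asboolP[n' [c' [x' [xD' ->]]]].
rewrite mulr_suml; apply: (sumD) => i; rewrite mulr_sumr; apply: (sumD) => j.
rewrite -[_ * _]/(crossed_mul _ _).
rewrite (crossed_mul_homogE _ _ (xD i) (xD' j)); apply: scal.
rewrite addrACA -opprD; apply: diag_gen; exact: homogM.
Qed.

HB.instance Definition _ := GRing.isSubalgClosed.Build F crossed diag_pred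
  (GRing.subalg_closed_semi diag_subalg).

(* The subalgebra A' of crossed D r. *)
Definition diag : Type := {t : crossed | t \in diag_pred}.

HB.instance Definition _ := SubChoice.on diag.
HB.instance Definition _ := [SubChoice_isSubAlgebra of diag by <:].

End CrossedTensor.

(* Main.v *)
(** On homogeneous elements the product of [x ⊗ e^(g-h)] and [y ⊗ e^(g'-h')] is
    [r(g+h,g'-h') r(g-h,g'+h') xy ⊗ e^(g+g'-(h+h'))] with [r] the square root of
    [sigma]; the mixed factors [r(g,h')] and [r(h,g')] cancel, leaving
    [r(g,g')^2 r(h,h')^-2], the factor of the twisted product. The inverse of
    [phi] is induced by the augmentation of [F[G]]. *)
Require Import Defs.
From HB Require Import structures.
From mathcomp Require Import all_boot all_algebra.
From mathcomp Require Import boolp ring.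

Set Implicit Arguments.
Unset Strict Implicit.
Unset Printing Implicit Defensive.

Import GRing.Theory.
Local Open Scope ring_scope.

Section DiagonalMap.
Variables (F : fieldType) (G : zmodType) (A : hopfType F) (D : bigrading G A).
Variable r : skew_bicharacter F G.

(** The map [phi] with values in the ambient algebra, where linearity and products can be handled
    before restricting to the subalgebra. *)
Definition diag_map : A -> crossed D r :=
  homog_ext D (fun i x => diag_tensor D r i.1 i.2 x).

Lemma diag_tensor_linear g h : linear (diag_tensor D r g h).
Proof. exact: tpure_linearl. Qed.

Lemma diag_map_linear : linear diag_map.
Proof. by apply: homog_ext_linear => i; exact: diag_tensor_linear. Qed.

Lemma diag_mapE g h x : x \in D g h -> diag_map x = diag_tensor D r g h x.
Proof.
move=> xD; apply: (homog_extE (f := fun i => diag_tensor D r i.1 i.2)) => // i.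
exact: diag_tensor_linear.
Qed.

(** By definition [diag_map x] is a finite sum over the homogeneous components of [x], and each
    summand is a generator of [diag_pred]. *)
Lemma diag_map_in x : diag_map x \in @diag_pred F G A D r.
Proof.
apply: rpred_sum => i _; apply: diag_gen.
exact: dcomp_in.
Qed.

(** The augmentation sends every [e^m] to 1, so it undoes [diag_map] on homogeneous elements, and
    these span [A]. *)
Lemma forget_diag_map x : forget (diag_map x) = x.
Proof.
apply: (homog_ind (D := D) (f1 := fun x => forget (diag_map x)) (f2 := id)) => //.
  exact: linear_comp (@forget_linear _ _ _) diag_map_linear.
by move=> v [g [h vD]]; rewrite (diag_mapE vD) forgetE.
Qed.

Lemma diag_map_forget t : t \in @diag_pred F G A D r -> diag_map (forget t) = t.
Proof.
have fl : linear (fun t : crossed D r => diag_map (forget t)).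
  exact: linear_comp diag_map_linear (@forget_linear _ _ _).
move=> /asboolP[n [c [x [xD ->]]]].
(* Coefficients 1 bring the sum into the shape of [linear_eq_sum], which reduces the claim to single
   generators. *)
under eq_bigr do rewrite -[diag_tensor _ _ _ _ _]scale1r.
rewrite (linear_eq_sum _ (fun=> 1) _ fl); apply: eq_bigr => i _.
by rewrite forgetE (diag_mapE (xD i)).
Qed.

Variable s : skew_bicharacter F G.
Hypothesis sqrtE : forall a b, r a b ^+ 2 = s a b.

Lemma skewBl a b c : r (a - b) c = r a c / r b c.
Proof.
by apply: (mulIf (skew_neq0 r b c)); rewrite -skewDl subrK divfK ?skew_neq0.
Qed.

Lemma skewBr a b c : r a (b - c) = r a b / r a c.
Proof.
by apply: (mulIf (skew_neq0 r a c)); rewrite -skewDr subrK divfK ?skew_neq0.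
Qed.

(** Both sides are bilinear, so homogeneous [x] and [y] suffice, taken one argument at a time. *)
Lemma diag_mapM (x y : A) : diag_map (twist_mul D s x y) = diag_map x * diag_map y.
Proof.
have lM := diag_map_linear.
apply: (homog_ind (D := D) (f1 := fun x => diag_map (twist_mul D s x y))
   (f2 := fun x => diag_map x * diag_map y)).
- exact: linear_comp lM (twist_mul_linearl D s y).
- exact: linear_comp (mulr_linearl _) lM.
move=> {}x [g [h xD]].
apply: (homog_ind (D := D) (f1 := fun y => diag_map (twist_mul D s x y))
   (f2 := fun y => diag_map x * diag_map y)).
- exact: linear_comp lM (twist_mul_linearr D s x).
- exact: linear_comp (mulr_linearr _) lM.
move=> {}y [g' [h' yD]].
rewrite (twist_mulE s xD yD) (linear_scale lM).
rewrite (diag_mapE xD) (diag_mapE yD).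
rewrite (diag_mapE (homogM xD yD)).
rewrite -[RHS]/(crossed_mul D r _ _) (crossed_mul_homogE r _ _ xD yD).
(* The exponents agree since [(g + g') - (h + h') = (g - h) + (g' - h')]; only the scalars
   remain. *)
rewrite /diag_tensor opprD addrACA; congr (_ *: _).
rewrite -!sqrtE skewBr skewBl !skewDl !skewDr; field.
by rewrite !skew_neq0.
Qed.

Lemma diag_map1 : diag_map 1 = 1.
Proof. by rewrite (diag_mapE (homog1 D)) /diag_tensor subr0. Qed.

Definition twist_diag (x : twist D s) : diag D r := Sub (diag_map x) (diag_map_in x).

Fact twist_diag_linear : linear twist_diag.
Proof. by move=> c x y; apply: val_inj; exact: diag_map_linear. Qed.

Fact twist_diag_monoid : monoid_morphism twist_diag.
Proof.
by split=> [|x y]; apply: val_inj; [exact: diag_map1|exact: diag_mapM].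
Qed.

HB.instance Definition _ :=
  GRing.isLinear.Build F (twist D s) (diag D r) _ twist_diag twist_diag_linear.

Lemma twist_diag_bij : bijective twist_diag.
Proof.
exists (fun t => forget (val t)) => [x|t]; first exact: forget_diag_map.
by apply: val_inj; apply: diag_map_forget; exact: valP.
Qed.

End DiagonalMap.

Theorem proposition5p3 (F : closedFieldType) (G : zmodType) (A : hopfType F)
    (D : bigrading G A) (sigma sqrt_sigma : skew_bicharacter F G)
    (sqrt_sigmaE : forall a b : G, sqrt_sigma a b ^+ 2 = sigma a b) :
  exists phi : {lrmorphism twist D sigma -> diag D sqrt_sigma},
    [/\ forall (g h : G) (x : A), x \in D g h ->
          val (phi x) = x *t gbasis F (g - h),
        bijective phi
      & forall psi : {linear A -> diag D sqrt_sigma},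
          (forall (g h : G) (x : A), x \in D g h ->
             val (psi x) = x *t gbasis F (g - h)) ->
          psi =1 phi].
Proof.
have phiE g h (x : A) : x \in D g h ->
    val (@twist_diag F G A D sqrt_sigma sigma x) = x *t gbasis F (g - h).
  exact: diag_mapE.
(* Multiplicativity rests on [sqrt_sigmaE], so this structure is built here and joined to the linear
   one already declared. *)
pose phiM := GRing.isMonoidMorphism.Build _ _ _
  (twist_diag_monoid D sqrt_sigmaE).
pose phi : {lrmorphism twist D sigma -> diag D sqrt_sigma} :=
  HB.pack (@twist_diag F G A D sqrt_sigma sigma) phiM.
exists phi; split=> [||psi psiE]; [exact: phiE|exact: twist_diag_bij|].
(* Uniqueness: two linear maps that agree on homogeneous elements are equal. *)
apply: (homog_ind (D := D)) => [||x [g [h xD]]]; first exact: linearP.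
  exact: twist_diag_linear.
by apply: val_inj; rewrite (psiE g h x xD) (phiE g h x xD).
Qed.
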